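(* Let $\mathbf{K}$ be a class of similar algebras regarded as a category with homomorphisms as morphisms, let $\mathfrak{A},\mathfrak{B}\in\mathbf{K}$, and suppose a coproduct $\mathfrak{A}\oplus\mathfrak{B}\in\mathbf{K}$ of $\mathfrak{A}$ and $\mathfrak{B}$ in $\mathbf{K}$ exists, with $\mathfrak{A}$ and $\mathfrak{B}$ regarded as subalgebras of $\mathfrak{A}\oplus\mathfrak{B}$ via the coproduct embeddings. If $\mathfrak{A}\vee\mathfrak{B}=\mathfrak{A}\oplus\mathfrak{B}$, then $\mathfrak{A}$ and $\mathfrak{B}$ are subalgebra-independent in $\mathfrak{A}\oplus\mathfrak{B}$.
   Context: All algebras have the same similarity type. For subalgebras $\mathfrak{A},\mathfrak{B}$ of an algebra $\mathfrak{X}$ (with universes $A,B$), $\mathfrak{A}\vee\mathfrak{B}$ is the subalgebra of $\mathfrak{X}$ generated by $A\cup B$. $\mathfrak{A}$ and $\mathfrak{B}$ are subalgebra-independent in $\mathfrak{X}$ if for any homomorphisms $\alpha:\mathfrak{A}\to\mathfrak{A}$ and $\beta:\mathfrak{B}\to\mathfrak{B}$ there is a homomorphism $\gamma:\mathfrak{A}\vee\mathfrak{B}\to\mathfrak{A}\vee\mathfrak{B}$ with $\gamma(a)=\alpha(a)$ for all $a\in A$ and $\gamma(b)=\beta(b)$ for all $b\in B$. Coproduct: given $\mathfrak{A}_1,\mathfrak{A}_2\in\mathbf{K}$ and embeddings $e_i:\mathfrak{A}_i\to\mathfrak{C}$ ($i=1,2$) with $\mathfrak{C}\in\mathbf{K}$,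 $\mathfrak{C}$ is a coproduct of $\mathfrak{A}_1$ and $\mathfrak{A}_2$ in $\mathbf{K}$ if for any $\mathfrak{D}\in\mathbf{K}$ and homomorphisms $f_i:\mathfrak{A}_i\to\mathfrak{D}$ there is a homomorphism $g:\mathfrak{C}\to\mathfrak{D}$ such that $f_i=g\circ e_i$ ($i=1,2$). It is denoted $\mathfrak{A}_1\oplus\mathfrak{A}_2$, and $\mathfrak{A}_1,\mathfrak{A}_2$ are identified with their images under $e_1,e_2$. *)

(* Defs.v *)
From mathcomp Require Import all_boot.
From mathcomp Require Import boolp classical_sets.
Set Implicit Arguments.
Unset Strict Implicit.
Unset Printing Implicit Defensive.
Local Open Scope classical_set_scope.

(* A similarity type: operation symbols with finite arities. *)
Record signature := Signature { symbol : Type; arity : symbol -> nat }.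

(* The empty carrier is not excluded; a class of algebras may exclude it. *)
Record algebra (sg : signature) := Algebra {
  carrier :> Type;
  op : forall f : symbol sg, ('I_(arity f) -> carrier) -> carrier }.

Arguments op {sg} a f x.

Record hom (sg : signature) (A B : algebra sg) := Hom {
  hom_fun :> A -> B;
  hom_op : forall (f : symbol sg) (x : 'I_(arity f) -> A),
    hom_fun (op A f x) = op B f (fun i => hom_fun (x i)) }.

Section Subalgebras.
Variables (sg : signature) (X : algebra sg).

Definition op_closed (S : set X) : Prop :=
  forall (f : symbol sg) (x : 'I_(arity f) -> X),
    (forall i, S (x i)) -> S (op X f x).

Record subalgebra := Subalgebra {
  universe : set X;
  universe_closed : op_closed universe }.

Definition sub_op (S : subalgebra) (f : symbol sg)
    (x : 'I_(arity f) -> set_type (universe S)) : set_type (universe S) :=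
  exist _ (op X f (fun i => val (x i)))
    (mem_set (universe_closed (fun i => set_mem (valP (x i))))).

Definition subalgebra_algebra (S : subalgebra) : algebra sg :=
  Algebra (@sub_op S).

Definition inclusion (S T : subalgebra) (ST : universe S `<=` universe T)
    (x : subalgebra_algebra S) : subalgebra_algebra T :=
  exist _ (val x) (mem_set (ST _ (set_mem (valP x)))).

Lemma smallest_op_closed (G : set X) : op_closed (smallest op_closed G).
Proof.
by move=> f x Gx T [clT GT]; apply: (clT) => i; apply: Gx; split.
Qed.

Definition generated (G : set X) : subalgebra :=
  Subalgebra (@smallest_op_closed G).

Definition join (A B : subalgebra) : subalgebra :=
  generated (universe A `|` universe B).

Lemma sub_joinl (A B : subalgebra) : universe A `<=` universe (join A B).
Proof. by move=> x Ax T [_ ABT]; apply: ABT; left. Qed.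

Lemma sub_joinr (A B : subalgebra) : universe B `<=` universe (join A B).
Proof. by move=> x Bx T [_ ABT]; apply: ABT; right. Qed.

Definition joinl (A B : subalgebra) := inclusion (@sub_joinl A B).
Definition joinr (A B : subalgebra) := inclusion (@sub_joinr A B).

End Subalgebras.

Arguments joinl {sg X A} B x.
Arguments joinr {sg X} A {B} x.

Coercion subalgebra_algebra : subalgebra >-> algebra.

Definition subalgebra_independent (sg : signature) (X : algebra sg)
    (A B : subalgebra X) : Prop :=
  forall (alpha : hom A A) (beta : hom B B),
  exists gamma : hom (join A B) (join A B),
    (forall a : A, gamma (joinl B a) = joinl B (alpha a)) /\
    (forall b : B, gamma (joinr A b) = joinr A (beta b)).

Lemma range_op_closed (sg : signature) (A C : algebra sg) (e : hom A C) :
  op_closed (range e).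
Proof.
move=> f x ex; have /choice[y yx] : forall i, exists a, e a = x i.
  by move=> i; have [a _ ea] := ex i; exists a.
exists (op A f y) => //; rewrite hom_op; congr op.
by apply/funext => i; rewrite yx.
Qed.

Definition hom_image (sg : signature) (A C : algebra sg) (e : hom A C) :
  subalgebra C := Subalgebra (@range_op_closed sg A C e).

(* The mediating homomorphism g is not required to be unique, while e1 and e2
   are required to be embeddings. *)
Definition is_coproduct (sg : signature) (K : algebra sg -> Prop)
    (A1 A2 C : algebra sg) (e1 : hom A1 C) (e2 : hom A2 C) : Prop :=
  [/\ K C, injective e1, injective e2 &
    forall D : algebra sg, K D ->
    forall (f1 : hom A1 D) (f2 : hom A2 D),
    exists g : hom C D,
      (forall a, f1 a = g (e1 a)) /\ (forall a, f2 a = g (e2 a))].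

(* Main.v *)
Require Import Defs.
From mathcomp Require Import all_boot.
From mathcomp Require Import boolp classical_sets.
Set Implicit Arguments.
Unset Strict Implicit.
Unset Printing Implicit Defensive.
Local Open Scope classical_set_scope.

(** Endomorphisms [alpha] and [beta] of the two images, precomposed with the
    surjections of [A] and [B] onto these images ([corestriction]) and
    postcomposed with the inclusions into [C] ([sub_val]), are homomorphisms
    [A -> C] and [B -> C].  As [C] itself lies in [K], it is an admissible
    target for the coproduct property, which yields one endomorphism [g] of
    [C] inducing both.  Every element of an image comes from [A] or [B], so
    [g] extends [alpha] and [beta].  Finally the join is all of [C], so [g] is
    also an endomorphism of the join: [into_full] turns its values into
    elements of the join. *)

Section Homomorphisms.
Variable sg : signature.

Lemma hom_comp_op (A B C : algebra sg) (g : hom B C) (f : hom A B)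
    (s : symbol sg) (x : 'I_(arity s) -> A) :
  g (f (op A s x)) = op C s (fun i => g (f (x i))).
Proof. by rewrite !hom_op. Qed.

Definition hom_comp (A B C : algebra sg) (g : hom B C) (f : hom A B) :
  hom A C := @Hom sg A C (g \o f) (hom_comp_op g f).

Definition sub_val (X : algebra sg) (S : subalgebra X) : hom S X :=
  @Hom sg S X (fun x : S => val x) (fun _ _ => erefl).

Definition corestrict (A C : algebra sg) (e : hom A C) (a : A) : hom_image e :=
  exist _ (e a) (mem_set (imageT e a)).

Lemma corestrict_op (A C : algebra sg) (e : hom A C)
    (s : symbol sg) (x : 'I_(arity s) -> A) :
  corestrict e (op A s x) = op (hom_image e) s (fun i => corestrict e (x i)).
Proof. by apply: val_inj; rewrite /= hom_op. Qed.

Definition corestriction (A C : algebra sg) (e : hom A C) :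
  hom A (hom_image e) := Hom (corestrict_op e).

Lemma corestriction_surj (A C : algebra sg) (e : hom A C) (y : hom_image e) :
  exists a, corestriction e a = y.
Proof.
have [a _ eay] := set_mem (valP y).
by exists a; apply: val_inj.
Qed.

Lemma in_full (X : algebra sg) (T : subalgebra X)
    (fullT : universe T = [set: X]) (x : X) : x \in universe T.
Proof. by rewrite fullT in_setT. Qed.

Definition into_full_fun (X : algebra sg) (T : subalgebra X)
    (fullT : universe T = [set: X]) (x : X) : T := exist _ x (in_full fullT x).

Lemma into_full_op (X : algebra sg) (T : subalgebra X)
    (fullT : universe T = [set: X]) (s : symbol sg) (x : 'I_(arity s) -> X) :
  into_full_fun fullT (op X s x) =
  op T s (fun i => into_full_fun fullT (x i)).
Proof. exact: val_inj. Qed.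

Definition into_full (X : algebra sg) (T : subalgebra X)
    (fullT : universe T = [set: X]) : hom X T := Hom (into_full_op fullT).

(** An extension of [alpha] to the ambient algebra need only be tested on
    generators [e a], which is the form in which a coproduct provides it. *)
Lemma extends_on_image (A C : algebra sg) (e : hom A C)
    (alpha : hom (hom_image e) (hom_image e)) (g : hom C C) :
  (forall a, sub_val _ (alpha (corestriction e a)) = g (e a)) ->
  forall y : hom_image e, g (sub_val _ y) = sub_val _ (alpha y).
Proof. by move=> ge y; have [a <-] := corestriction_surj y; rewrite ge. Qed.

End Homomorphisms.

Theorem proposition2p4 (sg : signature) (K : algebra sg -> Prop)
    (A B C : algebra sg) (e1 : hom A C) (e2 : hom B C)
    (KA : K A) (KB : K B) (coprodC : is_coproduct K e1 e2)
    (joinC : universe (join (hom_image e1) (hom_image e2)) = [set: C]) :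
  subalgebra_independent (hom_image e1) (hom_image e2).
Proof.
move=> alpha beta; have [KC _ _ univC] := coprodC.
have [g [g1 g2]] := univC C KC
  (hom_comp (sub_val _) (hom_comp alpha (corestriction e1)))
  (hom_comp (sub_val _) (hom_comp beta (corestriction e2))).
exists (hom_comp (into_full joinC) (hom_comp g (sub_val _))).
by split=> y; apply: val_inj; apply: extends_on_image.
Qed.
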